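(* Let $L$ be a (possibly infinite) bounded lattice with least element $0$ and greatest element $1$, let $n\ge 2$ be an integer, and let $f\colon L^n\to L$ be an aggregation function. Then for every $\mathbf{x}\in L^n$ the following supremum and infimum exist in $L$ and $$f(\mathbf{x})=\bigvee_{\mathbf{a}\in L^n_*}h_{\mathbf{a}}(\mathbf{x})\qquad\text{and}\qquad f(\mathbf{x})=\bigwedge_{\mathbf{a}\in L^n_*}g_{\mathbf{a}}(\mathbf{x}).$$
   Context: An $n$-ary aggregation function on a bounded lattice $L$ with bounds $0,1$ is a map $A\colon L^n\to L$ that is monotone ($A(\mathbf{x})\le A(\mathbf{y})$ whenever $\mathbf{x}\le\mathbf{y}$ componentwise) and satisfies $A(0,\dots,0)=0$ and $A(1,\dots,1)=1$. $L^n_*=L^n\setminus\{(0,\dots,0),(1,\dots,1)\}$. For $a\in L$: $\chi_a(x)=1$ if $x\ge a$ and $x\ne 0$, and $\chi_a(x)=0$ otherwise; $\mu_a(x)=0$ if $x\le a$ and $x\neq 1$, and $\mu_a(x)=1$ otherwise. For $b\in L$: $x\oplus_b y=1$ if $x=y=1$; $x\oplus_b y=0$ if $x=y=0$; $x\oplus_b y=b$ otherwise. The operation $\oplus_b$ is associative and commutative, and $\bigoplus_{i=1}^n{}_{b}\,x_i$ denotes $x_1\oplus_b x_2\oplus_b\cdots\oplus_b x_n$. For $\mathbf{a}=(a_1,\dots,a_n)\in L^n_*$ put $J_{\mathbf{a}}=\{1\le i\le n: a_i\ne 0\}$ and $\hat J_{\mathbf{a}}=\{1\le i\le n: a_i\neq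 1\}$ (both nonempty), and, for the given $f$, $$h_{\mathbf{a}}(x_1,\dots,x_n)=\bigwedge_{i\in J_{\mathbf{a}}}\chi_{a_i}(x_i)\ \wedge\ \bigoplus_{i=1}^n{}_{f(\mathbf{a})}\,x_i,\qquad g_{\mathbf{a}}(x_1,\dots,x_n)=\bigvee_{i\in \hat J_{\mathbf{a}}}\mu_{a_i}(x_i)\ \vee\ \bigoplus_{i=1}^n{}_{f(\mathbf{a})}\,x_i.$$ An empty supremum is $0$ and an empty infimum is $1$ (relevant only if $L$ has one element). *)

(* Defs.v *)
From mathcomp Require Import all_boot all_order.
From mathcomp Require Import classical_sets.

Set Implicit Arguments.
Unset Strict Implicit.
Unset Printing Implicit Defensive.

Import Order.TTheory.
Local Open Scope order_scope.

(* [L^n] is [n.-tupleprod L]: tuples under the componentwise order, whose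
   [\bot] and [\top] are the constant tuples (0,...,0) and (1,...,1). *)

Section AggregationFunctions.
Context {d : Order.disp_t} {L : tbLatticeType d}.

Definition aggregation (n : nat) (A : n.-tupleprod L -> L) : Prop :=
  [/\ {homo A : x y / x <= y}, A \bot = \bot & A \top = \top].

Definition Lstar (n : nat) : set (n.-tupleprod L) :=
  [set a | a <> \bot /\ a <> \top]%classic.

Definition chi (a x : L) : L :=
  if (a <= x) && (x != \bot) then \top else \bot.

Definition mu (a x : L) : L :=
  if (x <= a) && (x != \top) then \bot else \top.

Definition oplus (b x y : L) : L :=
  if (x == \top) && (y == \top) then \top
  else if (x == \bot) && (y == \bot) then \bot
  else b.

Lemma oplusC (b : L) : commutative (oplus b).
Proof. by move=> x y; rewrite /oplus andbC [(x == \bot) && _]andbC. Qed.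

Lemma oplusA (b : L) : associative (oplus b).
Proof.
move=> x y z; case: (eqVneq (\top : L) \bot) => [e|n10].
  have E (u : L) : u = \bot by apply/eqP; rewrite -lex0 -e lex1.
  by rewrite [LHS]E [RHS]E.
have n01 : \bot != \top :> L by rewrite eq_sym.
have tri (u : L) :
    [\/ u = \top, u = \bot | (u == \top = false) * (u == \bot = false)].
  have [->|ut] := eqVneq u \top; first exact: Or31.
  by have [->|ub] := eqVneq u \bot; [exact: Or32 | exact: Or33].
have E := (eqxx, negPf n10, negPf n01).
rewrite /oplus.
by case: (tri x) => [->|->|xE]; case: (tri y) => [->|->|yE];
  case: (tri z) => [->|->|zE]; case: (tri b) => [->|->|bE];
  do 4! rewrite ?E ?xE ?yE ?zE ?bE /=.
Qed.

(* [oplus b] has no neutral element in general, so the iteration starts from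
   the first term; the value on the empty sequence is a dummy. *)
Definition bigoplus (b : L) (s : seq L) : L :=
  if s is x :: s' then foldl (oplus b) x s' else \bot.

Definition J (n : nat) (a : n.-tupleprod L) : {set 'I_n} :=
  [set i | tnth a i != \bot].

Definition Jhat (n : nat) (a : n.-tupleprod L) : {set 'I_n} :=
  [set i | tnth a i != \top].

Definition h (n : nat) (f : n.-tupleprod L -> L) (a x : n.-tupleprod L) : L :=
  (\meet_(i in J a) chi (tnth a i) (tnth x i)) `&` bigoplus (f a) x.

Definition g (n : nat) (f : n.-tupleprod L -> L) (a x : n.-tupleprod L) : L :=
  (\join_(i in Jhat a) mu (tnth a i) (tnth x i)) `|` bigoplus (f a) x.

End AggregationFunctions.

Arguments Lstar {d L n}.

(* Main.v *)
Require Import Defs.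
From mathcomp Require Import all_boot all_order.
From mathcomp Require Import classical_sets.

(** For every [a], the function [h a] lies below [f]: its [chi]-part vanishes
    unless [a <= x], and then the [oplus]-part is the top element (only at the
    top tuple), the bottom element (only at the bottom tuple) or [f a <= f x].
    The value [f x] is attained at [a = x] if [x] is in [Lstar], and at any [a]
    in [Lstar] if [x] is the top tuple ([Lstar] is empty only if [L] is
    trivial); at the bottom tuple there is nothing to prove.  The argument for
    [g] is dual. *)

Set Implicit Arguments.
Unset Strict Implicit.

Import Order.Theory.
Local Open Scope order_scope.

Section Representation.
Context {d : Order.disp_t} {L : tbLatticeType d}.
Implicit Types (b c u v : L) (s : seq L).

Lemma tnth_bot n i : tnth (\bot : n.-tupleprod L) i = \bot.
Proof. by rewrite botEtprod tnth_mktuple. Qed.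

Lemma tnth_top n i : tnth (\top : n.-tupleprod L) i = \top.
Proof. by rewrite topEtprod tnth_mktuple. Qed.

Lemma oplus_cases b u v :
  [\/ [/\ oplus b u v = \top, u = \top & v = \top],
      [/\ oplus b u v = \bot, u = \bot & v = \bot]
    | oplus b u v = b].
Proof.
rewrite /oplus; case: ifP => [/andP[/eqP-> /eqP->]|_]; first exact: Or31.
by case: ifP => [/andP[/eqP-> /eqP->]|_]; [exact: Or32 | exact: Or33].
Qed.

(** In the two exceptional cases of [oplus_cases] the value equals the first argument, which here is
    [b] itself. *)
Lemma oplus_absorb b u : oplus b b u = b.
Proof. by case: (oplus_cases b b u) => [[-> ->]|[-> ->]|]. Qed.

Lemma foldl_oplus_absorb b s : foldl (oplus b) b s = b.
Proof. by elim: s => //= y s IH; rewrite oplus_absorb. Qed.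

(* Singletons are excluded, since there the sum is the arbitrary single term;
   hence the hypothesis [2 <= n] in what follows. *)
Lemma bigoplus_seq_cases b u v s :
  let t := [:: u, v & s] in
  [\/ bigoplus b t = \top /\ all (pred1 \top) t,
      bigoplus b t = \bot /\ all (pred1 \bot) t
    | bigoplus b t = b].
Proof.
elim: s u v => [|y s IH] u v /=.
  by case: (oplus_cases b u v) => [[-> -> ->]|[-> -> ->]|->];
    [apply: Or31|apply: Or32|apply: Or33]; rewrite //= !eqxx.
(* A value [\top] or [\bot] of the first two terms becomes the new head for [IH]; the mixed
   alternatives force [\top = \bot], recorded in [cu]. A value [b] absorbs all later terms. *)
case: (oplus_cases b u v) => [[-> -> ->]|[-> -> ->]|->].
- case: (IH \top y) => [[E /andP[/= cu ys]]|[E /andP[/= cu ys]]|E];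
    by [apply: Or31; rewrite cu|apply: Or32; rewrite cu|apply: Or33].
- case: (IH \bot y) => [[E /andP[/= cu ys]]|[E /andP[/= cu ys]]|E];
    by [apply: Or31; rewrite cu|apply: Or32; rewrite cu|apply: Or33].
- by apply: Or33; rewrite oplus_absorb foldl_oplus_absorb.
Qed.

Lemma all_pred1_tuple n c (x y : n.-tuple L) :
  (forall i, tnth y i = c) -> all (pred1 c) x -> x = y.
Proof.
by move=> yc /all_tnthP xc; apply: eq_from_tnth => i; rewrite yc; apply/eqP/xc.
Qed.

Lemma bigoplus_cases n b (x : n.-tupleprod L) : (2 <= n)%N ->
  [\/ bigoplus b x = \top /\ x = \top,
      bigoplus b x = \bot /\ x = \bot
    | bigoplus b x = b].
Proof.
case: n x => [|[|n]] // x _.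
have [[E xt]|[E xb]|E] : [\/ bigoplus b x = \top /\ all (pred1 \top) x,
    bigoplus b x = \bot /\ all (pred1 \bot) x | bigoplus b x = b].
- case/tupleP: x => u x; case/tupleP: x => v x; exact: bigoplus_seq_cases.
- by apply: Or31; split=> //; apply: all_pred1_tuple xt => i; exact: tnth_top.
- by apply: Or32; split=> //; apply: all_pred1_tuple xb => i; exact: tnth_bot.
- exact: Or33.
Qed.

Lemma foldl_nseq n c (op : L -> L -> L) : op c c = c ->
  foldl op c (nseq n c) = c.
Proof. by move=> cc; elim: n => //= n IH; rewrite cc. Qed.

Lemma nseq_tuple n c (x : n.-tuple L) :
  (forall i, tnth x i = c) -> tval x = nseq n c.
Proof.
move=> xc; have -> : x = [tuple of nseq n c] by
  apply: eq_from_tnth => i; rewrite xc (tnth_nth c) nth_nseq ltn_ord.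
by [].
Qed.

(** The trichotomy [bigoplus_cases] would still allow the value [b] here, so the constant list is
    folded directly. *)
Lemma bigoplus_top n b : (0 < n)%N ->
  bigoplus b (\top : n.-tupleprod L) = \top.
Proof.
case: n => // n _; rewrite (nseq_tuple (@tnth_top n.+1)) /=.
by apply: foldl_nseq; rewrite /oplus eqxx.
Qed.

Lemma bigoplus_bot n b : (0 < n)%N ->
  bigoplus b (\bot : n.-tupleprod L) = \bot.
Proof.
case: n => // n _; rewrite (nseq_tuple (@tnth_bot n.+1)) /=.
by apply: foldl_nseq; rewrite /oplus eqxx; case: eqP.
Qed.

Lemma bigoplus_Lstar n b (x : n.-tupleprod L) : (2 <= n)%N -> Lstar x ->
  bigoplus b x = b.
Proof. by move=> n2 [xb xt]; case: (bigoplus_cases b x n2) => [[]|[]|]. Qed.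

Lemma Lstar_nonempty n : (2 <= n)%N -> \bot <> \top :> L ->
  exists a : n.-tupleprod L, Lstar a.
Proof.
case: n => [|[|n]] // _ ne; pose i1 : 'I_n.+2 := lift ord0 ord0.
(* The tuple (1,0,...,0): coordinate [ord0] separates it from [\bot], coordinate [i1] from
   [\top]. *)
exists [tuple if i == ord0 then \top else \bot | i < n.+2]; split=> E; apply: ne.
  by have := congr1 (fun t => tnth t ord0) E; rewrite tnth_bot tnth_mktuple.
by have := congr1 (fun t => tnth t i1) E; rewrite tnth_top tnth_mktuple.
Qed.

(** For [a != \bot], as for indices in [J], the relation [a <= x] already forces the extra condition
    [x != \bot] in [chi]. *)
Lemma chi_le (a x : L) : a != \bot -> a <= x -> chi a x = \top.
Proof.
move=> a0 ax; rewrite /chi ax; case: eqP => //= x0.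
by move: a0; rewrite -lex0 -x0 ax.
Qed.

Lemma mu_ge (a x : L) : a != \top -> x <= a -> mu a x = \bot.
Proof.
move=> a1 xa; rewrite /mu xa; case: eqP => //= x1.
by move: a1; rewrite -le1x -x1 xa.
Qed.

(** A coordinate where [a <= x] fails has a nonzero entry of [a], so its index lies in [J a] and its
    factor [\bot] annihilates the meet. *)
Lemma meet_chi_bot n (a x : n.-tupleprod L) : ~~ (a <= x) ->
  \meet_(i in J a) chi (tnth a i) (tnth x i) = \bot.
Proof.
rewrite leEtprod negb_forall => /existsP[i aix]; apply/eqP; rewrite -lex0.
have iJ : i \in J a by rewrite inE; apply: contraNneq aix => ->; rewrite le0x.
by apply: (meets_max iJ); rewrite /chi (negPf aix).
Qed.

Lemma meet_chi_top n (a x : n.-tupleprod L) : a <= x ->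
  \meet_(i in J a) chi (tnth a i) (tnth x i) = \top.
Proof.
rewrite leEtprod => /forallP ax; apply: big1 => i; rewrite inE => a0.
exact: chi_le.
Qed.

Lemma join_mu_top n (a x : n.-tupleprod L) : ~~ (x <= a) ->
  \join_(i in Jhat a) mu (tnth a i) (tnth x i) = \top.
Proof.
rewrite leEtprod negb_forall => /existsP[i xia]; apply/eqP; rewrite -le1x.
have iJ : i \in Jhat a by rewrite inE; apply: contraNneq xia => ->; rewrite lex1.
by apply: (joins_min iJ); rewrite /mu (negPf xia).
Qed.

Lemma join_mu_bot n (a x : n.-tupleprod L) : x <= a ->
  \join_(i in Jhat a) mu (tnth a i) (tnth x i) = \bot.
Proof.
rewrite leEtprod => /forallP xa; apply: big1 => i; rewrite inE => a1.
exact: mu_ge.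
Qed.

Lemma h_le n (f : n.-tupleprod L -> L) (a x : n.-tupleprod L) :
  (2 <= n)%N -> aggregation f -> h f a x <= f x.
Proof.
move=> n2 [fmono f0 f1]; rewrite /h.
have [ax|nax] := boolP (a <= x); last by rewrite meet_chi_bot // meet0x le0x.
rewrite meet_chi_top // meet1x.
case: (bigoplus_cases (f a) x n2) => [[-> ->]|[-> _]|->].
- by rewrite f1.
- exact: le0x.
- exact: fmono.
Qed.

Lemma g_ge n (f : n.-tupleprod L -> L) (a x : n.-tupleprod L) :
  (2 <= n)%N -> aggregation f -> f x <= g f a x.
Proof.
move=> n2 [fmono f0 f1]; rewrite /g.
have [xa|nxa] := boolP (x <= a); last by rewrite join_mu_top // join1x lex1.
rewrite join_mu_bot // join0x.
case: (bigoplus_cases (f a) x n2) => [[-> _]|[-> ->]|->].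
- exact: lex1.
- by rewrite f0.
- exact: fmono.
Qed.

Lemma h_diag n (f : n.-tupleprod L -> L) (x : n.-tupleprod L) :
  (2 <= n)%N -> Lstar x -> h f x x = f x.
Proof. by move=> n2 xS; rewrite /h meet_chi_top // meet1x bigoplus_Lstar. Qed.

Lemma g_diag n (f : n.-tupleprod L -> L) (x : n.-tupleprod L) :
  (2 <= n)%N -> Lstar x -> g f x x = f x.
Proof. by move=> n2 xS; rewrite /g join_mu_bot // join0x bigoplus_Lstar. Qed.

(** Every [a] lies below [\top], so the meet is [\top] and only the sum of the constant tuple
    remains. *)
Lemma h_top n (f : n.-tupleprod L -> L) (a : n.-tupleprod L) :
  (0 < n)%N -> h f a \top = \top.
Proof. by move=> n0; rewrite /h meet_chi_top ?lex1 // meet1x bigoplus_top. Qed.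

Lemma g_bot n (f : n.-tupleprod L -> L) (a : n.-tupleprod L) :
  (0 < n)%N -> g f a \bot = \bot.
Proof. by move=> n0; rewrite /g join_mu_bot ?le0x // join0x bigoplus_bot. Qed.

End Representation.

Theorem mainTheorem2 (d : Order.disp_t) (L : tbLatticeType d) (n : nat)
    (hn : (2 <= n)%N) (f : n.-tupleprod L -> L) (hf : aggregation f)
    (x : n.-tupleprod L) :
  supremums [set h f a x | a in Lstar]%classic (f x) /\
  infimums [set g f a x | a in Lstar]%classic (f x).
Proof.
have n0 : (0 < n)%N by exact: ltnW.
have [_ f0 f1] := hf.
split; split.
- by move=> _ [a _ <-]; exact: h_le.
- move=> y yub; have ub a : Lstar a -> h f a x <= y by move=> aS; apply: yub; exists a.
  have [->|/eqP xb] := eqVneq x \bot; first by rewrite f0 le0x.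
  have [xt|/eqP xt] := eqVneq x \top; last by rewrite -(h_diag f hn) //; exact: ub.
  (* In the one-element lattice [Lstar] is empty, and [f x = \top = \bot] lies below any [y]. *)
  have [e|/eqP ne] := eqVneq (\bot : L) \top; first by rewrite xt f1 -e le0x.
  have [a aS] := Lstar_nonempty hn ne.
  by rewrite xt f1 -(h_top f a) // -xt; exact: ub.
- by move=> _ [a _ <-]; exact: g_ge.
- move=> y ylb; have lb a : Lstar a -> y <= g f a x by move=> aS; apply: ylb; exists a.
  (* The bounds exchange roles: [\top] is now the trivial case, and at [\bot] any member of [Lstar]
     attains the value. *)
  have [->|/eqP xt] := eqVneq x \top; first by rewrite f1 lex1.
  have [xb|/eqP xb] := eqVneq x \bot; last by rewrite -(g_diag f hn) //; exact: lb.
  have [e|/eqP ne] := eqVneq (\bot : L) \top; first by rewrite xb f0 e lex1.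
  have [a aS] := Lstar_nonempty hn ne.
  by rewrite xb f0 -(g_bot f a) // -xb; exact: lb.
Qed.
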